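(* For all $n\ge1$ we have $A^{FC}_{n-1}(q)=M^*_n(q)$; equivalently, $A^{FC}(x)=M^*(x)-1$, where $A^{FC}(x)=\sum_{n\ge1}x^nA^{FC}_{n-1}(q)$.
   Context: Type $A_{n-1}$: Coxeter graph the path $s_1,\dots,s_{n-1}$ with all edges $m=3$, non-adjacent generators commuting (for $n=1$, the trivial group). An element is fully commutative (FC) if any of its reduced expressions can be obtained from any other one using only commutation relations. $A^{FC}_{n-1}(q)=\sum_wq^{\ell(w)}$ over FC elements $w$ of the Coxeter group of type $A_{n-1}$, $\ell$ the Coxeter length. $\mathcal{M}^*_n$ is the set of walks $P=(P_0,\dots,P_n)$ of points $P_i=(i,h_i)\in\mathbb{N}^2$ with $P_0=(0,0)$, $P_n=(n,0)$, steps in $\{(1,1),(1,-1),(1,0)\}$, each horizontal step labeled $L$ or $R$, with all horizontal steps at height $0$ labeled $L$. $M^*_n(q)=\sum_{P\in\mathcal{M}^*_n}q^{\sum_{i=0}^nh_i}$ and $M^*(x)=\sum_{n\ge0}M^*_n(q)x^n$. *)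

(* Defs.v *)
From HB Require Import structures.
From mathcomp Require Import all_boot all_order all_fingroup all_algebra.
From mathcomp Require Import generic_quotient.
From mathcomp Require Import boolp classical_sets functions cardinality fsbigop.

Set Implicit Arguments.
Unset Strict Implicit.
Unset Printing Implicit Defensive.

Import GRing.Theory.

(* The entry 0 stands for m(s, t) = oo (no relation between s and t). *)
Record coxeterMatrix (S : choiceType) := CoxeterMatrix {
  cox_m :> S -> S -> nat;
  cox_m_sym : forall s t, cox_m s t = cox_m t s;
  cox_m_eq1 : forall s t, (cox_m s t == 1) = (s == t)
}.

Section CoxeterGroup.
Variables (S : choiceType) (m : coxeterMatrix S).
Implicit Types (s t : S) (u v : seq S).

(* The monoid congruence on words generated by (s t)^m(s,t) = 1. For s = t this
   says s^2 = 1, so the quotient monoid is the group with the same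
   presentation. *)
Inductive cox_eqv : seq S -> seq S -> Prop :=
| cox_rel s t : cox_eqv (flatten (nseq (m s t) [:: s; t])) [::]
| cox_refl u : cox_eqv u u
| cox_sym u v : cox_eqv u v -> cox_eqv v u
| cox_trans u v w : cox_eqv u v -> cox_eqv v w -> cox_eqv u w
| cox_cat u u' v v' : cox_eqv u u' -> cox_eqv v v' -> cox_eqv (u ++ v) (u' ++ v').

Definition cox_eqvb : rel (seq S) := fun u v => `[< cox_eqv u v >].

Lemma cox_eqvb_equiv : equiv_class_of cox_eqvb.
Proof.
split=> [u|u v|v u w].
- by apply/asboolP; exact: cox_refl.
- by apply/asboolP/asboolP; exact: cox_sym.
- by move=> /asboolP uv /asboolP vw; apply/asboolP; exact: cox_trans uv vw.
Qed.

Canonical cox_equiv := EquivRelPack cox_eqvb_equiv.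

Definition coxeter_group := {eq_quot cox_equiv}%qT.
HB.instance Definition _ := Choice.on coxeter_group.
HB.instance Definition _ := Quotient.on coxeter_group.

Definition cox_class u : coxeter_group := (\pi_coxeter_group u)%qT.

Lemma cox_classP u v : (cox_class u = cox_class v) <-> cox_eqv u v.
Proof.
split=> [/eqP|uv]; first by rewrite /cox_class eqmodE => /asboolP.
by apply/eqP; rewrite eqmodE; exact/asboolP.
Qed.

Lemma cox_class_repr (x : coxeter_group) : cox_class (repr x) = x.
Proof. exact: reprK. Qed.

Definition cox_one : coxeter_group := cox_class [::].
Definition cox_mul (x y : coxeter_group) := cox_class (repr x ++ repr y).
Definition cox_inv (x : coxeter_group) := cox_class (rev (repr x)).

Lemma cox_repr_class u : cox_eqv (repr (cox_class u)) u.
Proof. by apply/cox_classP; rewrite cox_class_repr. Qed.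

Lemma cox_mul_class u v :
  cox_mul (cox_class u) (cox_class v) = cox_class (u ++ v).
Proof. by apply/cox_classP; apply: cox_cat; exact: cox_repr_class. Qed.

Lemma cox_eqv_ss s : cox_eqv [:: s; s] [::].
Proof.
by have := cox_rel s s; have /eqP -> : cox_m m s s == 1 by rewrite cox_m_eq1.
Qed.

Lemma cox_eqv_cat_rev u : cox_eqv (u ++ rev u) [::].
Proof.
elim: u => [|s u IHu]; first exact: cox_refl.
have -> : (s :: u) ++ rev (s :: u) = [:: s] ++ (u ++ rev u) ++ [:: s].
  by rewrite rev_cons -cats1 /= catA.
apply: cox_trans (cox_eqv_ss s); rewrite -[in X in cox_eqv _ X](cat1s s [:: s]).
apply: cox_cat; first exact: cox_refl.
by rewrite -[X in cox_eqv _ X]cat0s; exact: cox_cat IHu (cox_refl _).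
Qed.

Lemma cox_mulA : associative cox_mul.
Proof.
move=> x y z; rewrite -(cox_class_repr x) -(cox_class_repr y).
by rewrite -(cox_class_repr z) !cox_mul_class catA.
Qed.

Lemma cox_mul1 : left_id cox_one cox_mul.
Proof. by move=> x; rewrite -(cox_class_repr x) cox_mul_class. Qed.

Lemma cox_mulx1 : right_id cox_one cox_mul.
Proof. by move=> x; rewrite -(cox_class_repr x) cox_mul_class cats0. Qed.

Lemma cox_mulxV : right_inverse cox_one cox_inv cox_mul.
Proof.
move=> x; rewrite -{1}(cox_class_repr x) cox_mul_class.
by apply/cox_classP; exact: cox_eqv_cat_rev.
Qed.

Lemma cox_mulVx : left_inverse cox_one cox_inv cox_mul.
Proof.
move=> x; rewrite -{2}(cox_class_repr x) cox_mul_class; apply/cox_classP.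
by rewrite -{2}(revK (repr x)); exact: cox_eqv_cat_rev.
Qed.

HB.instance Definition _ :=
  isGroup.Build coxeter_group cox_mulA cox_mul1 cox_mulx1 cox_mulVx cox_mulxV.

Definition cox_gen s : coxeter_group := cox_class [:: s].

Definition word_prod u : coxeter_group := (\prod_(s <- u) cox_gen s)%g.

Lemma word_prodE u : word_prod u = cox_class u.
Proof.
rewrite /word_prod; elim: u => [|s u IHu]; first by rewrite big_nil.
by rewrite big_cons IHu -[LHS]/(cox_mul _ _) cox_mul_class.
Qed.

Lemma has_word_size (x : coxeter_group) :
  exists k, `[< exists2 u, word_prod u = x & size u = k >].
Proof.
exists (size (repr x)); apply/asboolP; exists (repr x) => //.
by rewrite word_prodE cox_class_repr.
Qed.

Definition cox_length (x : coxeter_group) : nat := ex_minn (has_word_size x).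

Definition reduced_expr (x : coxeter_group) u : Prop :=
  word_prod u = x /\ size u = cox_length x.

Inductive comm_eqv : seq S -> seq S -> Prop :=
| comm_refl u : comm_eqv u u
| comm_step u v s t w : m s t = 2 ->
    comm_eqv (u ++ [:: s; t] ++ v) w -> comm_eqv (u ++ [:: t; s] ++ v) w.

Definition fully_commutative (x : coxeter_group) : Prop :=
  forall u v, reduced_expr x u -> reduced_expr x v -> comm_eqv u v.

(* The sum is over a possibly infinite set: it is the library's finitely
   supported sum, equal to the usual one as soon as there are finitely many
   fully commutative elements (in particular when the group is finite). *)
Definition FC_poly : {poly int} :=
  (\sum_(x \in [set x | fully_commutative x]) ('X^(cox_length x) : {poly int}))%R.

End CoxeterGroup.

Definition typeA_m (r : nat) (i j : 'I_r) : nat :=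
  if i == j then 1 else if (i.+1 == j) || (j.+1 == i) then 3 else 2.

Lemma typeA_m_sym r (i j : 'I_r) : typeA_m i j = typeA_m j i.
Proof. by rewrite /typeA_m eq_sym orbC. Qed.

Lemma typeA_m_eq1 r (i j : 'I_r) : (typeA_m i j == 1) = (i == j).
Proof. by rewrite /typeA_m; case: (i == j) => //; case: ifP. Qed.

(* The generator s_(i+1) is i : 'I_r. *)
Definition typeA (r : nat) : coxeterMatrix 'I_r :=
  CoxeterMatrix (@typeA_m_sym r) (@typeA_m_eq1 r).

Definition AFC (r : nat) : {poly int} := FC_poly (typeA r).

Inductive step := Up | Down | HorL | HorR.

Definition bools_of_step (a : step) : bool * bool :=
  match a with
  | Up => (true, true) | Down => (true, false)
  | HorL => (false, true) | HorR => (false, false)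
  end.
Definition step_of_bools (b : bool * bool) : step :=
  match b with
  | (true, true) => Up | (true, false) => Down
  | (false, true) => HorL | (false, false) => HorR
  end.
Lemma bools_of_stepK : cancel bools_of_step step_of_bools.
Proof. by case. Qed.
HB.instance Definition _ := Finite.copy step (can_type bools_of_stepK).

Definition rise (a : step) : int :=
  match a with Up => 1%R | Down => (-1)%R | HorL | HorR => 0%R end.

Section Walks.
Variables (n : nat) (p : n.-tuple step).

(* The walk starting at (0, 0) with steps p visits the points (i, height i),
   for i = 0, ..., n. *)
Definition height (i : nat) : int := (\sum_(j < n | (j < i)%N) rise (tnth p j))%R.

Definition in_Mstar : bool :=
  [&& [forall i : 'I_n.+1, (0 <= height i)%R],
      height n == 0%R &
      [forall j : 'I_n, (height j == 0%R) ==> (tnth p j != HorR)]].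

Definition area : nat := \sum_(i < n.+1) `|height i|%N.

End Walks.

Definition Mstar (n : nat) : {poly int} :=
  (\sum_(p : n.-tuple step | in_Mstar p) 'X^(area p))%R.

(* Formal power series in x over Z[q], as sequences of coefficients. *)
Definition fps := nat -> {poly int}.
Definition fps_one : fps := fun n => ((n == 0)%:R)%R.
Definition fps_sub (f g : fps) : fps := fun n => (f n - g n)%R.

Definition AFC_series : fps := fun n => if n is r.+1 then AFC r else 0%R.
Definition Mstar_series : fps := fun n => Mstar n.

(* Main.v *)
Require Import Defs.
From mathcomp Require Import all_boot all_order all_algebra.
From mathcomp Require Import boolp classical_sets functions fsbigop.
From mathcomp Require Import zify.

Set Implicit Arguments.
Unset Strict Implicit.
Unset Printing Implicit Defensive.

(** Write the generators of type A as letters 0, ..., r - 1, adjacent when they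
    differ by one. In the heap of a fully commutative element the occurrences of
    two adjacent letters k - 1 and k alternate. Let h_i be the number of
    occurrences of the letter i - 1; then h_k and h_(k+1) differ by at most one,
    and when they are equal and positive it remains to record which of the two
    letters comes first. This is a walk with labelled horizontal steps, and the
    sum of its heights is the length of the element. The theorem says that
    nothing is lost and nothing else is constrained. Three ingredients carry it.

    Faithfulness. Words act on positions by adjacent transpositions, and the
    number of positions j < i sent to i or beyond is a lower bound for the
    multiplicity of the letter i - 1 ([crossings_act_le]). For an alternating word
    this bound is attained, and whether the position k is raised, lowered or fixed
    tells which of k - 1, k occurs first ([alt_word_act]). So the group element
    remembers the walk, and an alternating word has the least multiplicities
    among all words for its element.

    Full commutativity. Call a word rigid if it is shortest for its element and
    every word of the same length for that element has the same letters with
    multiplicity. Reduced words of fully commutative elements are rigid. A rigid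
    word admits no braid move, since that move changes multiplicities, and this
    forces alternation ([rigid_alt_word]); the converse is the minimality just
    described ([alt_word_rigid]). Two alternating words for the same element have
    the same restrictions to every pair of adjacent letters, hence are related by
    commutations ([restr_comm_eqv]), so the reduced words of that element, all
    rigid, form a single commutation class.

    Realisation. Any family of restrictions to the pairs k - 1, k with compatible
    multiplicities comes from a word, because the Coxeter graph is a path: letters
    can be inserted one generator at a time ([realizeP]). *)

Local Open Scope nat_scope.

(** * Restrictions of words to pairs of adjacent letters *)

(** The subword of [u] on the letters k - 1 and k, with true standing for k and
    false for k - 1. Taking k beyond either end of the alphabet leaves a single
    letter, so that alternation then says that the extreme letter occurs at most
    once. *)
Definition restr (k : nat) (u : seq nat) : bitseq :=
  [seq s == k | s <- u & (s == k) || (s.+1 == k)].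

(** The multiplicity of the letter i - 1, and 0 for i = 0: the shift makes it the
    height at abscissa i of the corresponding walk. *)
Definition mult (i : nat) (u : seq nat) : nat := count (fun s => s.+1 == i) u.

Definition alternating (b : bitseq) : bool := sorted (frel negb) b.

(** For every integer k the occurrences of k - 1 and k alternate; these words turn
    out to be the reduced words of the fully commutative elements. *)
Definition alt_word (u : seq nat) : Prop := forall k, alternating (restr k u).

Lemma restr_cons k s u :
  restr k (s :: u) = if (s == k) || (s.+1 == k) then (s == k) :: restr k u
                     else restr k u.
Proof. by rewrite /restr /=; case: ifP. Qed.

Lemma restr_cat k u v : restr k (u ++ v) = restr k u ++ restr k v.
Proof. by rewrite /restr filter_cat map_cat. Qed.

Lemma restr_nil k u : {in u, forall s, (s != k) && (s.+1 != k)} -> restr k u = [::].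
Proof.
elim: u => //= s u IHu free; rewrite restr_cons IHu.
  by have /andP[/negPf-> /negPf->] := free s (mem_head s u).
by move=> t tu; apply: free; rewrite in_cons tu orbT.
Qed.

Lemma count_restr_id k u : count id (restr k u) = mult k.+1 u.
Proof.
rewrite /mult; elim: u => //= s u IHu; rewrite restr_cons eqSS.
by case: (s == k) => /=; rewrite ?IHu //; case: ifP; rewrite /= ?IHu.
Qed.

Lemma count_restr_negb k u : count negb (restr k u) = mult k u.
Proof.
rewrite /mult; elim: u => //= s u IHu; rewrite restr_cons.
case: eqVneq => [->|_] /=; rewrite ?IHu; first by rewrite gtn_eqF ?ltnS.
by case: ifP; rewrite /= ?IHu.
Qed.

Lemma size_restr k u : size (restr k u) = mult k u + mult k.+1 u.
Proof. by rewrite -count_restr_negb -count_restr_id addnC count_predC. Qed.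

Lemma mult_cons i s u : mult i (s :: u) = (s.+1 == i) + mult i u.
Proof. by []. Qed.

Lemma alternatingE b :
  alternating b -> b = traject negb (head false b) (size b).
Proof. by case: b => //= c b /fpathE {1}->. Qed.

Lemma alternating_cons c b :
  alternating (c :: b) -> alternating b /\ ohead b != Some c.
Proof. by case: b => //= d b /andP[/eqP<- ->]; case: c. Qed.

Lemma alt_word_cons s u : alt_word (s :: u) -> alt_word u.
Proof.
move=> alt k; have := alt k; rewrite restr_cons; case: ifP => // _.
by case/alternating_cons.
Qed.

(** * Words acting by adjacent transpositions *)

Definition swap (s k : nat) : nat :=
  if k == s then s.+1 else if k == s.+1 then s else k.

Variant swap_spec (s k : nat) : nat -> Prop :=
| SwapLeft of k = s : swap_spec s k s.+1
| SwapRight of k = s.+1 : swap_spec s k s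
| SwapFix of k <> s & k <> s.+1 : swap_spec s k k.

Lemma swapP s k : swap_spec s k (swap s k).
Proof. by rewrite /swap; case: eqP => [?|?]; last case: eqP => ?; constructor. Qed.

Lemma swapK s : involutive (swap s).
Proof. by move=> k; do !case: swapP; lia. Qed.

Lemma swap_comm s t k :
  t != s.+1 -> t.+1 != s -> swap s (swap t k) = swap t (swap s k).
Proof. by move=> ts st; do !case: swapP; lia. Qed.

Lemma swap_braid s k :
  swap s (swap s.+1 (swap s k)) = swap s.+1 (swap s (swap s.+1 k)).
Proof. by do !case: swapP; lia. Qed.

(** The letters act from left to right, so that [act (s :: u)] is
    [act u \o swap s]: adding a letter in front permutes positions, not values. *)
Definition act (u : seq nat) (k : nat) : nat := foldl (fun j s => swap s j) k u.

(** Summed over i, this is half the total displacement of a permutation [f]. *)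
Definition crossings (f : nat -> nat) (i : nat) : nat :=
  count (fun j => i <= f j) (iota 0 i).

Lemma act_cat u v k : act (u ++ v) k = act v (act u k).
Proof. exact: foldl_cat. Qed.

(** Exchanging the positions s and s + 1 changes the set of the first i positions
    only when i = s + 1. *)
Lemma crossings_swap f s i :
  crossings (f \o swap s) i + (s.+1 == i) * (s < f s)
    = crossings f i + (s.+1 == i) * (s < f s.+1).
Proof.
have below m : m <= s ->
    count (fun j => i <= f (swap s j)) (iota 0 m) = count (fun j => i <= f j) (iota 0 m).
  move=> lems; apply: eq_in_count => j; rewrite mem_iota add0n => /andP[_ ltj].
  by rewrite /swap !ltn_eqF //; lia.
rewrite /crossings; case: (ltngtP s.+1 i) => [lt|lt|<-].
(* Both exchanged positions lie below i: the two summands trade places. *)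
- have -> : iota 0 i = iota 0 s ++ [:: s; s.+1] ++ iota s.+2 (i - s.+2).
    by rewrite -{1}(subnKC lt) -addn2 -addnA !iotaD add0n.
  rewrite !mul0n !addn0 !count_cat below // /= /swap !eqxx gtn_eqF //= !addn0.
  congr (_ + _); rewrite (addnC (i <= f s)); congr (_ + _).
  apply: eq_in_count => j; rewrite mem_iota => /andP[lej _].
  by rewrite !gtn_eqF //; lia.
- by rewrite !mul0n !addn0; apply: below; lia.
have -> : iota 0 s.+1 = iota 0 s ++ [:: s] by rewrite -addn1 iotaD add0n.
rewrite !count_cat /= !mul1n !addn0.
set A := count _ _; set B := count _ _; have -> : A = B.
  rewrite /A /B; apply: eq_in_count => j; rewrite mem_iota add0n => /andP[_ ltj].
  by rewrite /swap !ltn_eqF //; lia.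
by rewrite /swap eqxx; lia.
Qed.

Lemma crossings_act_le u i : crossings (act u) i <= mult i u.
Proof.
elim: u => [|s u IHu].
  rewrite /crossings /act /mult /= leqn0; apply/eqP.
  rewrite (@eq_in_count _ _ pred0) ?count_pred0 // => j; rewrite mem_iota /=; lia.
have := crossings_swap (act u) s i.
rewrite mult_cons -[_ \o _]/(act (s :: u)); case: (s.+1 == i); lia.
Qed.

(** Here c is the first letter, if any, of the restriction to k - 1 and k, and x is
    the image of the position k: in an alternating word the first letter that
    moves the position k also decides on which side of k it ends. *)
Definition side (c : option bool) (k x : nat) : bool :=
  match c with Some true => k < x | Some false => x < k | None => x == k end.

Lemma side_inj c d k x : side c k x -> side d k x -> c = d.
Proof. by case: c d => [[]|] [[]|] //=; lia. Qed.

(** Both claims are proved together, adding letters in front. If [s :: u] is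
    alternating then neither s - 1, s nor s, s + 1 may start with s in [u], so
    [act u] does not raise the position s and does not lower s + 1. Exchanging
    these positions creates exactly one new crossing at s + 1, raises s and
    lowers s + 1. *)
Lemma alt_word_act u : alt_word u ->
  (forall k, side (ohead (restr k u)) k (act u k)) /\
  (forall i, crossings (act u) i = mult i u).
Proof.
elim: u => [|s u IHu] alt.
  split=> [k|i] /=; first exact: eqxx.
  by apply/eqP; have := crossings_act_le [::] i; rewrite leqn0.
have [sideu cru] := IHu (alt_word_cons alt).
have up : s < act u s.+1.
  have := alt s.+1; rewrite restr_cons eqxx orbT ltn_eqF // => /alternating_cons[_].
  by have := sideu s.+1; case: (ohead _) => [[]|] //=; lia.
have dn : act u s <= s.
  have := alt s; rewrite restr_cons eqxx => /alternating_cons[_].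
  by have := sideu s; case: (ohead _) => [[]|] //=; lia.
split=> [k|i]; last first.
  have := crossings_swap (act u) s i; rewrite cru mult_cons -[_ \o _]/(act (s :: u)).
  case: (s.+1 == i); lia.
rewrite restr_cons /= /swap eq_sym.
case: (eqVneq k s) => [->|ks] //=.
by rewrite eq_sym; case: (eqVneq k s.+1) => [->|ks1] //=.
Qed.

(** An alternating sequence is determined by its length and its first element, and
    both can be read off the action. *)
Lemma alt_word_restr_inj u v :
  alt_word u -> alt_word v -> act u =1 act v -> forall k, restr k u = restr k v.
Proof.
move=> altu altv uv k.
have [su cu] := alt_word_act altu; have [sv cv] := alt_word_act altv.
have muv i : mult i u = mult i v by rewrite -cu -cv; apply: eq_count => j; rewrite uv.
rewrite (alternatingE (altu k)) (alternatingE (altv k)) !size_restr !muv.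
have := su k; rewrite uv => /side_inj/(_ (sv k)).
by case: (restr k u) (restr k v) => [|? ?] [|? ?] //= [->].
Qed.

(** * Words with prescribed restrictions *)

(** Inserts copies of k in a word on smaller letters: [b] says how they interleave
    with the occurrences of k - 1. Each false copies [u] up to and including the
    next k - 1; each true inserts a k. *)
Fixpoint merge_letter (k : nat) (b : bitseq) (u : seq nat) : seq nat :=
  match b with
  | [::] => u
  | true :: b' => k :: merge_letter k b' u
  | false :: b' =>
      let i := find (fun s => s.+1 == k) u in
      take i u ++ k.-1 :: merge_letter k b' (drop i.+1 u)
  end.

(** The new letter is invisible in the restrictions to smaller pairs, and relative
    to k - 1 it was placed as prescribed. The hypothesis on [b] is that it asks for
    exactly the occurrences of k - 1 that [u] has. *)
Lemma merge_letterP k b u :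
  all (ltn^~ k) u -> count negb b = mult k u ->
  [/\ restr k (merge_letter k b u) = b,
      forall j, j < k -> restr j (merge_letter k b u) = restr j u
    & all (ltn^~ k.+1) (merge_letter k b u)].
Proof.
elim: b u => [|[] b IHb] u ltu cnt /=.
- split=> //; last by apply: sub_all ltu => s /=; lia.
  apply/eqP; rewrite -size_eq0 size_restr -cnt /mult /= eqn0Ngt -has_count.
  by apply/hasPn => s /(allP ltu) /=; lia.
- have [r0 r1 r2] := IHb u ltu cnt; split; last by rewrite ltnSn.
    by rewrite restr_cons eqxx r0.
  by move=> j jk; rewrite restr_cons !gtn_eqF ?r1 //=; lia.
have hask : has (fun s => s.+1 == k) u by rewrite has_count -/(mult k u) -cnt.
move: cnt ltu; case: (split_find hask) => x u1 u2 /eqP xk nu1.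
rewrite cat_rcons /mult count_cat all_cat => /=.
have /eqP -> : count (fun s => s.+1 == k) u1 == 0 by rewrite -leqn0 leqNgt -has_count.
rewrite xk eqxx => -[cnt] /and3P[ltu1 _ ltu2]; have ltx : x < k by rewrite -xk.
have [r0 r1 r2] := IHb u2 ltu2 cnt; have -> : k.-1 = x by rewrite -xk.
split.
- rewrite restr_cat restr_cons r0 xk eqxx orbT (ltn_eqF ltx) restr_nil // => s su1.
  by rewrite (ltn_eqF (allP ltu1 s su1)) /=; apply: contra nu1 => sk; apply/hasP; exists s.
- move=> j jk; rewrite !restr_cat !restr_cons r1 //.
- rewrite all_cat; apply/and3P; split; [|exact: leqW|exact: r2].
  by apply: sub_all ltu1 => s /=; lia.
Qed.

Fixpoint realize (B : nat -> bitseq) (n : nat) : seq nat :=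
  if n is k.+1 then merge_letter k (B k) (realize B k) else [::].

Lemma realizeP (B : nat -> bitseq) n :
  count negb (B 0) = 0 ->
  (forall k, k.+1 < n -> count id (B k) = count negb (B k.+1)) ->
  all (ltn^~ n) (realize B n) /\ forall k, k < n -> restr k (realize B n) = B k.
Proof.
move=> B0; elim: n => [|n IHn] B_S //=.
have [|ltn_ restr_] := IHn; first by move=> k kn; apply: B_S; exact: leqW.
have [|rn rk ltS] := @merge_letterP n (B n) _ ltn_.
  case: n B_S {IHn ltn_} restr_ => [|n] B_S restr_ //.
  by rewrite -count_restr_id restr_ // B_S.
split=> // k; rewrite ltnS leq_eqVlt => /predU1P[-> //|kn].
by rewrite rk // restr_.
Qed.

(** * Rigid words *)

Section Coxeter.
Variables (S : choiceType) (m : coxeterMatrix S).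
Implicit Types (s t : S) (u v w : seq S) (x : coxeter_group m).

Lemma cox_eqv_catl w u v : cox_eqv m u v -> cox_eqv m (w ++ u) (w ++ v).
Proof. exact/cox_cat/cox_refl. Qed.

Lemma cox_eqv_catr w u v : cox_eqv m u v -> cox_eqv m (u ++ w) (v ++ w).
Proof. by move=> uv; exact: cox_cat uv (cox_refl m w). Qed.

(** A relation that kills [u ++ v] may be read as a rewriting of [u] into the
    inverse of [v]; this gives commutations and braid moves from the powers
    (s t)^m. *)
Lemma cox_eqv_rev u v : cox_eqv m (u ++ v) [::] -> cox_eqv m u (rev v).
Proof.
move=> uv; apply: (@cox_trans _ _ _ (u ++ (v ++ rev v))).
  by rewrite -{1}[u]cats0; apply/cox_eqv_catl/cox_sym/cox_eqv_cat_rev.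
by rewrite catA; exact: (cox_eqv_catr (rev v) uv).
Qed.

Lemma cox_eqv_comm s t : m s t = 2 -> cox_eqv m [:: s; t] [:: t; s].
Proof.
move=> mst; apply: (@cox_eqv_rev [:: s; t] [:: s; t]).
by have := cox_rel m s t; rewrite mst.
Qed.

Lemma cox_eqv_braid s t : m s t = 3 -> cox_eqv m [:: s; t; s] [:: t; s; t].
Proof.
move=> mst; apply: (@cox_eqv_rev [:: s; t; s] [:: t; s; t]).
by have := cox_rel m s t; rewrite mst.
Qed.

Lemma cox_eqv_slide s u :
  {in u, forall t, m s t = 2} -> cox_eqv m (s :: u) (rcons u s).
Proof.
elim: u => [|t u IHu] comm; first exact: cox_refl.
apply: (@cox_trans _ _ _ (t :: s :: u)).
  exact: (cox_eqv_catr u (cox_eqv_comm (comm t (mem_head t u)))).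
apply: (cox_eqv_catl [:: t]); apply: IHu => z zu.
by apply: comm; rewrite in_cons zu orbT.
Qed.

Lemma comm_eqv_cox u v : comm_eqv m u v -> cox_eqv m u v.
Proof.
elim=> {u v} [u|u v s t w mst _]; first exact: cox_refl.
apply: cox_trans; apply/cox_eqv_catl/cox_eqv_catr/cox_sym.
exact: cox_eqv_comm.
Qed.

Lemma comm_eqv_perm u v : comm_eqv m u v -> perm_eq u v.
Proof.
elim=> {u v} [u|u v s t w mst _]; first exact: perm_refl.
by apply: perm_trans; rewrite perm_cat2l perm_cat2r (perm_catC [:: t] [:: s]).
Qed.

Lemma comm_eqv_trans u v w : comm_eqv m u v -> comm_eqv m v w -> comm_eqv m u w.
Proof.
by move=> uv; elim: uv w => // {u v} a b s t v mst _ IH w /IH; exact: comm_step.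
Qed.

Lemma comm_eqv_cons s u v : comm_eqv m u v -> comm_eqv m (s :: u) (s :: v).
Proof.
elim=> {u v} [u|a b s' t v mst _ IH]; first exact: comm_refl.
exact: (comm_step (u := s :: a) mst IH).
Qed.

Lemma comm_eqv_front s u v :
  {in u, forall t, m s t = 2} -> comm_eqv m (u ++ s :: v) (s :: u ++ v).
Proof.
elim: u => [|t u IHu] comm /=; first exact: comm_refl.
apply: (@comm_eqv_trans _ (t :: s :: u ++ v)).
  by apply/comm_eqv_cons/IHu => z zu; apply: comm; rewrite in_cons zu orbT.
apply: (@comm_step _ m [::] (u ++ v) s t); last exact: comm_refl.
exact/comm/mem_head.
Qed.

(** Full commutativity seen through multiplicities only. Unlike full
    commutativity it is visibly inherited by factors ([rigid_infix]), and unlike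
    reducedness it excludes braid moves. *)
Definition rigid u : Prop := forall v, cox_eqv m u v ->
  size u <= size v /\ (size v = size u -> perm_eq u v).

Lemma rigid_infix u v w : rigid (u ++ v ++ w) -> rigid v.
Proof.
move=> rig v' vv'; have [] := rig (u ++ v' ++ w).
  exact/cox_eqv_catl/cox_eqv_catr.
rewrite !size_cat => le eq; split=> [|sz]; first lia.
by have := eq _; rewrite perm_cat2l perm_cat2r; apply; lia.
Qed.

Lemma cox_length_le u : cox_length (cox_class m u) <= size u.
Proof.
rewrite /cox_length; case: ex_minnP => k _; apply.
by apply/asboolP; exists u; rewrite ?word_prodE.
Qed.

Lemma reduced_exprP x u :
  reduced_expr x u <->
  cox_class m u = x /\ forall v, cox_eqv m u v -> size u <= size v.
Proof.
split=> [[]|[<- minu]].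
  rewrite word_prodE => <- sz; split=> // v /cox_classP uv.
  by rewrite sz uv cox_length_le.
split; rewrite ?word_prodE //; apply/eqP; rewrite eqn_leq cox_length_le andbT.
rewrite /cox_length; case: ex_minnP => k /asboolP[v] + <- _.
by rewrite word_prodE => /cox_classP/cox_sym/minu.
Qed.

Lemma reduced_expr_exists x : exists u, reduced_expr x u.
Proof.
rewrite /reduced_expr /cox_length; case: ex_minnP => k /asboolP[u ux uk] _.
by exists u.
Qed.

(** Commutations preserve multiplicities. *)
Lemma fully_commutative_rigid x u :
  fully_commutative x -> reduced_expr x u -> rigid u.
Proof.
move=> fc redu v uv; have /reduced_exprP[ux minu] := redu; split; first exact: minu.
move=> sz; apply/comm_eqv_perm/fc => //; apply/reduced_exprP; split.
  by rewrite -ux; apply/cox_classP/cox_sym.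
by move=> w vw; rewrite sz; apply/minu/cox_trans/vw.
Qed.

Lemma rigid_reduced u : rigid u -> reduced_expr (cox_class m u) u.
Proof. by move=> rig; apply/reduced_exprP; split=> // v /rig[]. Qed.

Lemma reduced_expr_rigid x u v :
  rigid u -> reduced_expr x u -> reduced_expr x v -> rigid v.
Proof.
move=> rigu /reduced_exprP[<- minu] /reduced_exprP[/cox_classP vu minv] w vw.
have sz : size u = size v.
  by apply/eqP; rewrite eqn_leq minv // minu //; exact: cox_sym.
have [szw permw] := rigu _ (cox_trans (cox_sym vu) vw).
have [_ permv] := rigu _ (cox_sym vu).
rewrite -sz; split=> // /permw; rewrite -(permPl (permv _)) //.
Qed.

End Coxeter.

(** * Rigid words and alternating words in type A *)

Section TypeA.
Variable r : nat.
Implicit Types (s t : 'I_r) (u v w : seq 'I_r).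

Notation vals u := (map (@nat_of_ord r) u).

Lemma typeA_eq2 s t : t != s.+1 :> nat -> t.+1 != s -> s != t -> typeA r s t = 2.
Proof.
move=> ts st; rewrite /= /typeA_m => /negPf->.
by rewrite eq_sym (negPf ts) (negPf st).
Qed.

Lemma typeA_eq3 s t : (t == s.+1 :> nat) || (t.+1 == s) -> typeA r s t = 3.
Proof.
move=> adj; rewrite /= /typeA_m; case: eqVneq => [st|_].
  by move: adj; rewrite st; lia.
by rewrite [s.+1 == t]eq_sym adj.
Qed.

Lemma act_cox_eqv u v : cox_eqv (typeA r) u v -> act (vals u) =1 act (vals v).
Proof.
elim=> {u v} [s t|//|u v _ IH j|u v w _ IH _ IH' j|u u' v v' _ IH _ IH' j] //.
- move=> j /=; rewrite /typeA_m; case: eqVneq => [->|_] /=; first exact: swapK.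
  case: ifP => /= [/orP[]/eqP <-|/negbT] /=; first by rewrite -swap_braid !swapK.
    by rewrite swap_braid !swapK.
  rewrite negb_or => /andP[ts st].
  by rewrite (@swap_comm t s) ?swapK //= eq_sym.
- by rewrite IH IH'.
- by rewrite !map_cat !act_cat IH IH'.
Qed.

Lemma count_mem_mult s u : count_mem s u = mult s.+1 (vals u).
Proof. by rewrite /mult count_map; apply: eq_count => t /=; rewrite eqSS. Qed.

Lemma sum_count_mem u : \sum_s count_mem s u = size u.
Proof.
elim: u => [|t u IHu] /=; first by rewrite big1.
rewrite big_split /= IHu (bigD1 t) //= eqxx big1 // => s /negPf st.
by rewrite eq_sym st.
Qed.

(** The numbers of crossings depend on the group element only. They equal the
    multiplicities in [u] and bound those in any other word, so a word of the same
    length has equality for each letter. *)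
Lemma alt_word_rigid u : alt_word (vals u) -> rigid (typeA r) u.
Proof.
move=> altu v /act_cox_eqv uv; have [_ cru] := alt_word_act altu.
have le s : count_mem s u <= count_mem s v ?= iff (count_mem s u == count_mem s v).
  split=> //; rewrite !count_mem_mult -cru.
  apply: leq_trans (crossings_act_le (vals v) s.+1).
  by rewrite /crossings; under eq_count => j do rewrite uv.
have := leqif_sum (P := predT) (fun s _ => le s); rewrite !sum_count_mem => -[szle szeq].
split=> // sz; move: szeq; rewrite sz eqxx => /esym/forallP eqs.
by apply/allP => s _; exact: eqs.
Qed.

Definition nbr s t : bool := (t == s.+1 :> nat) || (t.+1 == s).

(** With no neighbour of s in between, the two occurrences of s could be brought
    together and cancelled; with a single neighbour t, they could be brought
    around it and s t s replaced by t s t, which changes the multiplicity of s. *)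
Lemma rigid_two_nbrs s w :
  rigid (typeA r) (s :: rcons w s) -> s \notin w -> 2 <= count (nbr s) w.
Proof.
move=> rig sw; have comm z : {subset z <= w} -> ~~ has (nbr s) z ->
    {in z, forall t, typeA r s t = 2}.
  move=> zw nz t tz; apply: typeA_eq2; last by apply: contraNneq sw => ->; exact: zw.
    by apply: contra nz => ts; apply/hasP; exists t => //; rewrite /nbr ts.
  by apply: contra nz => ts; apply/hasP; exists t => //; rewrite /nbr ts orbT.
case: (boolP (has (nbr s) w)) => [|nw]; last first.
  have /rig[] : cox_eqv (typeA r) (s :: rcons w s) w.
    apply: (@cox_trans _ _ _ (w ++ [:: s; s])).
      rewrite -cat_rcons cats1 -rcons_cons.
      rewrite -!cats1; apply/cox_eqv_catr; rewrite cats1.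
      by apply/cox_eqv_slide/comm.
    by rewrite -{2}[w]cats0; apply/cox_eqv_catl/cox_eqv_ss.
  by rewrite /= size_rcons; lia.
move=> hasn; move: rig sw comm; case: (split_find hasn) => t y z nt ny rig sw comm.
rewrite count_cat -cats1 count_cat /= nt addn1.
case: (boolP (has (nbr s) z)) => [|nz]; first by rewrite has_count; lia.
have sy : s \notin y by apply: contra sw; rewrite mem_cat mem_rcons in_cons => ->; rewrite orbT.
have sz : s \notin z by apply: contra sw; rewrite mem_cat => ->; rewrite orbT.
have st : s != t by apply: contraNneq sw => ->; rewrite mem_cat mem_rcons mem_head.
have braid : cox_eqv (typeA r) (s :: rcons (rcons y t ++ z) s) (y ++ [:: t; s; t] ++ z).
  apply: (@cox_trans _ _ _ (y ++ [:: s; t; s] ++ z)); last first.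
    by apply/cox_eqv_catl/cox_eqv_catr/cox_eqv_braid/typeA_eq3.
  have -> : s :: rcons (rcons y t ++ z) s = (s :: y) ++ (t :: rcons z s).
    by rewrite rcons_cat cat_rcons.
  apply: (@cox_trans _ _ _ (rcons y s ++ (t :: s :: z))); last first.
    by rewrite cat_rcons; exact: cox_refl.
  apply: cox_cat.
    apply/cox_eqv_slide/comm => // i iy.
    by rewrite mem_cat mem_rcons in_cons iy orbT.
  apply/(cox_eqv_catl [:: t])/cox_sym/cox_eqv_slide/comm => // i iz.
  by rewrite mem_cat iz orbT.
have [_ /(_ _)/seq.permP/(_ (pred1 s))] := rig _ braid.
rewrite !size_cat /= !size_rcons size_cat size_rcons.
move=> /(_ ltac:(lia)).
rewrite !count_cat /= -!cats1 !count_cat /= !eqxx [t == s]eq_sym (negPf st).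
by rewrite -!/(count_mem s _) (count_memPn sy) (count_memPn sz).
Qed.

(** By induction on the distance of the two occurrences of s: if some neighbour t
    of s occurred twice in [w], two successive occurrences of t would have a
    neighbour of each kind in between, one of which is s, against s not being in
    [w]. So each of s + 1 and
    s - 1 occurs at most once, and by [rigid_two_nbrs] both occur. *)
Lemma rigid_between s w :
  rigid (typeA r) (s :: rcons w s) -> s \notin w ->
  has (fun t => t == s.+1 :> nat) w && has (fun t => t.+1 == s) w.
Proof.
have [n] := ubnP (size w); elim: n => // n IHn in s w * => ltn rig sw.
have one t : t \in w -> nbr s t -> count_mem t w <= 1.
  move=> tw st; rewrite leqNgt; apply: contra sw => two.
  have hasw : has (pred1 t) w by rewrite has_pred1.
  move: ltn rig two; case: (split_find hasw) => _ a z /eqP-> ta ltn rig.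
  rewrite count_cat -cats1 count_cat /= eqxx addn0 addn1.
  have /eqP -> : count_mem t a == 0 by rewrite -leqn0 leqNgt -has_count.
  rewrite add1n ltnS -has_count => hasz.
  move: ltn rig; case: (split_find hasz) => _ y b /eqP-> ty ltn rig.
  have rigy : rigid (typeA r) (t :: rcons y t).
    apply: (@rigid_infix _ _ (s :: a) _ (rcons b s)).
    by move: rig; rewrite !rcons_cat !cat_rcons /= cat_rcons.
  have sy : s \in y.
    have /andP[/hasP[t1 t1y /eqP t1t] /hasP[t2 t2y /eqP t2t]] :
        has (fun t' => t' == t.+1 :> nat) y && has (fun t' => t'.+1 == t) y.
      apply: IHn => //; last by rewrite -has_pred1.
      by move: ltn; rewrite !size_cat !size_rcons; lia.
    case/orP: st => /eqP st.
      by have -> : s = t2 by apply/val_inj => /=; lia.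
    by have -> : s = t1 by apply/val_inj => /=; lia.
  by rewrite !mem_cat mem_rcons in_cons sy !orbT.
have le1 (p : pred 'I_r) : (forall t, p t -> nbr s t) -> (forall t t', p t -> p t' -> t = t') ->
    count p w <= 1.
  move=> pn p1; have [/hasP[t tw pt]|] := boolP (has p w).
    rewrite (@eq_count _ _ (pred1 t)) ?one ?pn // => t' /=.
    by apply/idP/eqP => [/p1/(_ pt)//|->].
  by rewrite has_count -leqNgt; lia.
have := rigid_two_nbrs rig sw; rewrite !has_count.
have : count (nbr s) w <= count (fun t => t == s.+1 :> nat) w + count (fun t => t.+1 == s) w.
  by rewrite -count_predUI; exact: leq_addr.
have := le1 (fun t => t == s.+1 :> nat); have := le1 (fun t => t.+1 == s).
move=> /(_ _ _)/wrap[|t t1 /eqP E /eqP E1|lea].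
- by move=> t ts; rewrite /nbr ts orbT.
- by apply/val_inj => /=; lia.
move=> /(_ _ _)/wrap[|t t1 /eqP E /eqP E1|leb]; last lia.
- by move=> t ts; rewrite /nbr ts.
- by apply/val_inj => /=; lia.
Qed.

(** If the restriction to k - 1, k had two equal consecutive letters, then between
    the corresponding occurrences in [u] one of their two neighbours would be
    missing, against [rigid_between]. *)
Lemma rigid_alt_word u : rigid (typeA r) u -> alt_word (vals u).
Proof.
elim: u => [|s u IHu] // rig k.
have {}IHu : alternating (restr k (vals u)).
  by apply: IHu; apply: (@rigid_infix _ _ [:: s] _ [::]); rewrite cats0.
rewrite /= restr_cons; case: ifP => // sk.
have [/split_find|nk] := boolP (has (fun t : 'I_r => (t == k :> nat) || (t.+1 == k)) u); last first.
  rewrite restr_nil // => _ /mapP[t tu ->]; rewrite -negb_or.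
  by apply: contra nk => tk; apply/hasP; exists t.
move=> split; move: rig IHu; case: split => t y z tk yk rig.
have -> : restr k (vals (rcons y t ++ z)) = (t == k :> nat) :: restr k (vals z).
  rewrite map_cat map_rcons cat_rcons restr_cat restr_cons tk restr_nil // => _ /mapP[i iy ->].
  by rewrite -negb_or; apply: contra yk => ik; apply/hasP; exists i.
move=> alt; apply/andP; split=> //=; apply/negP => /negP same.
have st : s = t.
  by apply/val_inj => /=; move: same sk tk; do !case: eqP => //=; lia.
have sy : s \notin y by apply: contra yk => sy; apply/hasP; exists s.
have : rigid (typeA r) (s :: rcons y s).
  by apply: (@rigid_infix _ _ [::] _ z); move: rig; rewrite -st.
case/rigid_between/(_ sy)/andP => /hasP[t1 t1y /eqP t1s] /hasP[t2 t2y /eqP t2s].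
case/negP: yk; apply/hasP; case/orP: sk => /eqP sk.
  by exists t2 => //; rewrite t2s sk eqxx orbT.
by exists t1 => //; rewrite t1s sk eqxx.
Qed.

(** The projection criterion for traces. If [u] starts with s then no neighbour of
    s precedes the first s of [v], because restrictions to s and that neighbour
    start with s; so this s can be commuted to the front of [v], then
    cancelled. *)
Lemma restr_comm_eqv u v :
  (forall k, restr k (vals u) = restr k (vals v)) -> comm_eqv (typeA r) v u.
Proof.
elim: u v => [|s u IHu] v eqr.
  case: v eqr => [|t v] eqr; first exact: comm_refl.
  by have := eqr t; rewrite /= restr_cons eqxx.
have sv : s \in v.
  have := count_mem_mult s v; rewrite -count_restr_id -eqr /= restr_cons eqxx /=.
  by rewrite -has_pred1 has_count => ->.
have hasv : has (pred1 s) v by rewrite has_pred1.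
move: eqr; case: (split_find hasv) => _ x b /eqP -> sx eqr.
rewrite cat_rcons.
(* Before the first s, a letter of a pair k - 1, k containing s would be the other
   letter of that pair, and the restriction of [v] would start with it. *)
have free k t : (s == k :> nat) || (s.+1 == k) -> t \in x -> (t != k :> nat) && (t.+1 != k).
  move=> sk tx; rewrite -negb_or; apply/negP => tk.
  have : (t == k :> nat) \in restr k (vals x).
    apply/mapP; exists (val t); rewrite // mem_filter tk /=.
    by apply/mapP; exists t.
  have := eqr k; rewrite /= restr_cons sk map_cat map_rcons cat_rcons restr_cat.
  case E : (restr k (vals x)) => [//|c l] [same _] _.
  have : c \in restr k (vals x) by rewrite E mem_head.
  case/mapP => s'; rewrite mem_filter => /andP[s'k /mapP[t' t'x s't']] cs'.
  move: sx; rewrite has_pred1 => /negP; apply; suff -> : s = t' by [].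
  by apply/val_inj; move: sk s'k same; rewrite cs' s't' /=; do !case: eqP => //=; lia.
apply: (@comm_eqv_trans _ _ _ (s :: x ++ b)).
  apply: comm_eqv_front => t tx; apply: typeA_eq2.
  - by have /andP[] := free s.+1 t ltac:(by rewrite eqxx orbT) tx.
  - by have /andP[] := free s t ltac:(by rewrite eqxx) tx.
  - by apply: contraNneq sx => ->; rewrite has_pred1.
apply/comm_eqv_cons/IHu => k; have := eqr k.
rewrite /= restr_cons map_cat map_rcons cat_rcons !restr_cat restr_cons map_cat restr_cat.
case: ifP => // sk; rewrite [restr k (vals x)]restr_nil => [[]//|_ /mapP[t tx ->]].
exact: free.
Qed.

Lemma alt_word_eqv u v : alt_word (vals u) -> alt_word (vals v) ->
  cox_eqv (typeA r) u v <-> forall k, restr k (vals u) = restr k (vals v).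
Proof.
move=> altu altv; split=> [/act_cox_eqv|eqr]; first exact: alt_word_restr_inj.
exact/cox_sym/comm_eqv_cox/restr_comm_eqv.
Qed.

Lemma alt_word_fully_commutative u :
  alt_word (vals u) -> fully_commutative (cox_class (typeA r) u).
Proof.
move=> /alt_word_rigid rigu v w redv redw.
have altw z : reduced_expr (cox_class (typeA r) u) z -> alt_word (vals z).
  by move=> redz; apply/rigid_alt_word/(reduced_expr_rigid rigu (rigid_reduced rigu)).
apply/restr_comm_eqv/(alt_word_eqv (altw _ redw) (altw _ redv)).
by case: redv redw => vu _ [wu _]; apply/cox_classP; rewrite -!word_prodE vu wu.
Qed.

Lemma fully_commutative_alt_word (x : coxeter_group (typeA r)) :
  fully_commutative x -> exists2 u, cox_class (typeA r) u = x & alt_word (vals u).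
Proof.
move=> fcx; have [u redu] := reduced_expr_exists x; exists u.
  by have [<-] := redu; rewrite word_prodE.
exact/rigid_alt_word/(fully_commutative_rigid fcx redu).
Qed.

End TypeA.

(** * Steps of walks and alternating patterns *)

(** A restriction of odd length has one more letter of one kind, which then comes
    first; for even lengths the first letter is the label. The empty pattern gives
    [HorL], the only label allowed at height 0. *)
Definition step_of_pattern (b : bitseq) : step :=
  match odd (size b), head false b with
  | true, true => Up
  | true, false => Down
  | false, true => HorR
  | false, false => HorL
  end.

(** Here [h] is the height at the start of the step, that is the number of false.
    At height 0 a [Down] has the empty pattern, as the predecessor truncates;
    walks that stay nonnegative avoid this case. *)
Definition pattern_of_step (a : step) (h : nat) : bitseq :=
  match a with
  | Up => traject negb true h.*2.+1
  | Down => traject negb false h.*2.-1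
  | HorL => traject negb false h.*2
  | HorR => traject negb true h.*2
  end.

Lemma alternating_traject c n : alternating (traject negb c n).
Proof. by case: n => // n; exact: fpath_traject. Qed.

Lemma count_id_traject c n : count id (traject negb c n) = (n + c)./2.
Proof. by elim: n c => [|n IHn] [] //=; rewrite IHn /=; lia. Qed.

Lemma count_negb_traject c n : count negb (traject negb c n) = (n + ~~ c)./2.
Proof. by elim: n c => [|n IHn] [] //=; rewrite IHn /=; lia. Qed.

Lemma alternating_pattern_of_step a h : alternating (pattern_of_step a h).
Proof. by case: a; exact: alternating_traject. Qed.

Lemma count_negb_pattern a h : count negb (pattern_of_step a h) = h.
Proof. by case: a; rewrite count_negb_traject /=; lia. Qed.

Lemma count_id_pattern a h :
  (0 <= h%:Z + rise a)%R -> ((count id (pattern_of_step a h))%:Z = h%:Z + rise a)%R.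
Proof. by case: a; rewrite count_id_traject /=; lia. Qed.

Lemma step_of_patternK b :
  alternating b -> pattern_of_step (step_of_pattern b) (count negb b) = b.
Proof.
move=> /alternatingE E; rewrite [in RHS]E [in count _ _]E count_negb_traject.
rewrite /step_of_pattern; case: (boolP (odd _)) => odd_b; case: (head false b);
  rewrite /pattern_of_step; congr traject; lia.
Qed.

Lemma rise_step_of_pattern b : alternating b ->
  (rise (step_of_pattern b) = (count id b)%:Z - (count negb b)%:Z)%R.
Proof.
move=> /alternatingE E; rewrite [in count id _]E [in count negb _]E.
rewrite count_negb_traject count_id_traject /step_of_pattern.
by case: (boolP (odd _)) => odd_b; case: (head false b) E => /=; lia.
Qed.

Lemma pattern_of_stepK a h :
  (0 <= h%:Z + rise a)%R -> (a == HorR -> 0 < h) -> step_of_pattern (pattern_of_step a h) = a.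
Proof.
rewrite /step_of_pattern; case: a => /=.
- by rewrite size_traject odd_double.
- by case: h => [|h] //=; rewrite size_traject odd_double.
- by case: h => [|h] //=; rewrite size_traject odd_double.
- by case: h => [|h] //=; [move=> _ /(_ isT) | rewrite size_traject odd_double].
Qed.

(** * The bijection *)

Import GRing.Theory.

Section Walks.
Variable r : nat.
Implicit Types (p : r.+1.-tuple step) (u : seq 'I_r).

Notation vals u := (map (@nat_of_ord r) u).

Lemma height0 p : height p 0 = 0%R.
Proof. by rewrite /height big_pred0. Qed.

Lemma heightS p (k : 'I_r.+1) :
  (height p k.+1 = height p k + rise (tnth p k))%R.
Proof.
rewrite /height (bigD1 k) //= addrC; congr (_ + _)%R.
by apply: eq_bigl => j; rewrite ltnS [j < k]ltn_neqAle andbC.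
Qed.

Lemma in_Mstar_height p (k : nat) :
  in_Mstar p -> k <= r.+1 -> (`|height p k|%N%:Z = height p k)%R.
Proof. by case/and3P=> /forallP pos _ _ kr; have := pos (Ordinal (kr : k < r.+2)) => /=; lia. Qed.

Definition patterns_of_walk p (k : nat) : bitseq :=
  pattern_of_step (nth Up p k) `|height p k|%N.

Lemma in_Mstar_rise p (k : 'I_r.+1) : in_Mstar p ->
  (0 <= `|height p k|%N%:Z + rise (tnth p k))%R.
Proof.
move=> Mp; rewrite (in_Mstar_height Mp (ltnW (ltn_ord k))) -heightS.
by have := in_Mstar_height Mp (ltn_ord k); lia.
Qed.

Lemma count_id_patterns_of_walk p (k : 'I_r.+1) : in_Mstar p ->
  count id (patterns_of_walk p k) = `|height p k.+1|%N.
Proof.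
move=> Mp; have := count_id_pattern (in_Mstar_rise k Mp).
rewrite (in_Mstar_height Mp (ltnW (ltn_ord k))) -heightS /patterns_of_walk (tnth_nth Up).
by lia.
Qed.

Definition word_of_walk p : seq 'I_r :=
  pmap insub (realize (patterns_of_walk p) r.+1).

(** The walk ends at height 0, so the last letter r inserted by the realisation
    has multiplicity 0 and [insub] discards nothing. *)
Lemma word_of_walkP p : in_Mstar p ->
  forall k, k < r.+1 -> restr k (vals (word_of_walk p)) = patterns_of_walk p k.
Proof.
move=> Mp; have [||ltu patu] := @realizeP (patterns_of_walk p) r.+1.
- by rewrite count_negb_pattern height0.
- move=> k kr; rewrite count_negb_pattern.
  exact: (count_id_patterns_of_walk (Ordinal (ltnW kr : k < r.+1))).
suff -> : vals (word_of_walk p) = realize (patterns_of_walk p) r.+1 by [].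
rewrite /word_of_walk (pmap_filter (@insubK _ _ _)); apply/all_filterP.
apply/allP => s su /=; rewrite isSome_insub ltn_neqAle.
have := allP ltu s su; rewrite /= ltnS => ->; rewrite andbT.
have noR : count_mem r (realize (patterns_of_walk p) r.+1) = 0.
  rewrite -[LHS]/(mult r.+1 _) -count_restr_id patu //.
  rewrite (count_id_patterns_of_walk (ord_max : 'I_r.+1) Mp) /=.
  by have /and3P[_ /eqP-> _] := Mp.
by apply/eqP => sr; have /count_memPn := noR; rewrite -{1}sr su.
Qed.

Lemma restr_out u k : r < k -> restr k (vals u) = [::].
Proof. by move=> rk; apply: restr_nil => _ /mapP[s _ ->]; have := ltn_ord s; lia. Qed.

Lemma word_of_walk_alt p : in_Mstar p -> alt_word (vals (word_of_walk p)).
Proof.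
move=> Mp k; have [kr|rk] := ltnP k r.+1; last by rewrite restr_out.
by rewrite word_of_walkP //; exact: alternating_pattern_of_step.
Qed.

Lemma sum_mult u : \sum_(i < r.+2) mult i (vals u) = size u.
Proof.
elim: u => [|s u IHu]; first by rewrite big1.
transitivity (1 + \sum_(i < r.+2) mult i (vals u)); last by rewrite IHu.
under eq_bigr do rewrite map_cons mult_cons.
rewrite big_split /=; congr (_ + _).
rewrite (bigD1 (Ordinal (leqW (ltn_ord s) : s.+1 < r.+2))) //= eqxx big1 // => i.
by rewrite -val_eqE /= eq_sym => /negPf->.
Qed.

Lemma mult_word_of_walk p i : in_Mstar p -> i < r.+2 ->
  mult i (vals (word_of_walk p)) = `|height p i|%N.
Proof.
move=> Mp; rewrite ltnS leq_eqVlt => /predU1P[->|ir]; last first.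
  by rewrite -count_restr_negb word_of_walkP // count_negb_pattern.
rewrite -count_restr_id word_of_walkP //.
exact: (count_id_patterns_of_walk (ord_max : 'I_r.+1)).
Qed.

Lemma size_word_of_walk p : in_Mstar p -> size (word_of_walk p) = area p.
Proof.
by move=> Mp; rewrite -sum_mult; apply: eq_bigr => i _; rewrite mult_word_of_walk.
Qed.

Definition walk_of_word u : r.+1.-tuple step :=
  [tuple step_of_pattern (restr i (vals u)) | i < r.+1].

Lemma word_of_walkK p : in_Mstar p -> walk_of_word (word_of_walk p) = p.
Proof.
move=> Mp; apply: eq_from_tnth => k; rewrite tnth_mktuple word_of_walkP //.
rewrite /patterns_of_walk -tnth_nth; apply: pattern_of_stepK; first exact: in_Mstar_rise.
have /and3P[_ _ /forallP/(_ k)/implyP lab] := Mp.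
by move/eqP=> pk; rewrite absz_gt0; apply/negP => /lab; rewrite pk.
Qed.

Lemma height_walk_of_word u i : alt_word (vals u) -> i < r.+2 ->
  height (walk_of_word u) i = (mult i (vals u))%:Z%R.
Proof.
move=> altu; elim: i => [|i IHi] ir.
  by rewrite height0 /mult (@eq_count _ _ pred0) ?count_pred0.
rewrite (heightS _ (Ordinal (ir : i < r.+1))) tnth_mktuple /= IHi; last exact: ltnW.
by rewrite rise_step_of_pattern // count_restr_id count_restr_negb addrC subrK.
Qed.

Lemma walk_of_word_in_Mstar u : alt_word (vals u) -> in_Mstar (walk_of_word u).
Proof.
move=> altu; apply/and3P; split.
- by apply/forallP => i; rewrite height_walk_of_word.
- by rewrite height_walk_of_word // -count_restr_negb restr_out.
apply/forallP => k; apply/implyP; rewrite height_walk_of_word //; last exact: leqW.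
rewrite tnth_mktuple -count_restr_negb => /eqP -[c0].
by rewrite -(step_of_patternK (altu k)) c0; case: (step_of_pattern (restr _ _)).
Qed.

(** Going through the walk recovers the word only up to commutations, that is, its
    restrictions. *)
Lemma walk_of_wordK u : alt_word (vals u) ->
  forall k, restr k (vals (word_of_walk (walk_of_word u))) = restr k (vals u).
Proof.
move=> altu k; have Mu := walk_of_word_in_Mstar altu.
have [kr|rk] := ltnP k r.+1; last by rewrite !restr_out.
rewrite word_of_walkP // /patterns_of_walk height_walk_of_word //; last exact: leqW.
rewrite -(tnth_nth Up _ (Ordinal kr)) tnth_mktuple /= -count_restr_negb.
exact: step_of_patternK.
Qed.

Lemma AFC_Mstar : AFC r = Mstar r.+1.
Proof.
rewrite /AFC /FC_poly.
rewrite (@reindex_fsbig _ _ _ _ _ (fun p => cox_class (typeA r) (word_of_walk p))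
  [set p | in_Mstar p]%classic); last first.
  split=> [p /= Mp|p p' /set_mem Mp /set_mem Mp' /= /cox_classP|x /= fcx].
  - exact/alt_word_fully_commutative/word_of_walk_alt.
  - move/(alt_word_eqv (word_of_walk_alt Mp) (word_of_walk_alt Mp')) => eqr.
    rewrite -(word_of_walkK Mp) -(word_of_walkK Mp').
    by apply: eq_from_tnth => k; rewrite !tnth_mktuple eqr.
  have [u ux altu] := fully_commutative_alt_word fcx.
  exists (walk_of_word u); first exact: walk_of_word_in_Mstar.
  rewrite -ux; apply/cox_classP/alt_word_eqv => //.
    exact/word_of_walk_alt/walk_of_word_in_Mstar.
  exact: walk_of_wordK.
rewrite -(@bigfs _ _ _ _ (index_enum _)) ?index_enum_uniq //; last first.
  by move=> p _; rewrite mem_index_enum.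
apply: eq_bigr => p Mp; congr ('X^_)%R; rewrite -size_word_of_walk //.
have [_ <-//] := rigid_reduced (alt_word_rigid (word_of_walk_alt Mp)).
Qed.

End Walks.

Lemma Mstar0 : Mstar 0 = 1%R.
Proof.
have height_nil (p : 0.-tuple step) i : height p i = 0%R by rewrite /height big_ord0.
rewrite /Mstar (bigD1 [tuple]) /=; last first.
  apply/and3P; split; rewrite ?height_nil //; last by apply/forallP=> -[].
  by apply/forallP=> i; rewrite height_nil.
rewrite big1 ?addr0 => [|p /andP[_ /eqP[]]]; last exact: tuple0.
by rewrite /area big1 // => i _; rewrite height_nil.
Qed.

Theorem proposition2p7 :
  (forall n : nat, 1 <= n -> AFC n.-1 = Mstar n) /\
  AFC_series = fps_sub Mstar_series fps_one.
Proof.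
split=> [[|n] // _|]; first exact: AFC_Mstar.
apply/funext => -[|n]; rewrite /fps_sub /Mstar_series /fps_one /=.
  by rewrite Mstar0 subrr.
by rewrite AFC_Mstar subr0.
Qed.
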